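(* Let $(M,g)$ be a compact, oriented smooth Riemannian manifold (with or without boundary) and let $v$ be a smooth vector field on $M$. If $v^\flat\in\mathcal{H}^1(M)$, then $v^\flat\in\mathcal{H}^1_v(M)$ if and only if $v(\|v\|_g^2)=0$, i.e. the squared norm of $v$ does not change in the direction of $v$ itself. In particular, $v^\flat\in\mathcal{H}^1_v(M)$ holds when $v$ (with $v^\flat\in\mathcal{H}^1(M)$) has constant pointwise norm.
   Context: $\Omega^k(M)$ is the space of smooth differential $k$-forms, $d$ the exterior derivative, $\star$ the Hodge star of $g$, and $\delta=(-1)^k\star^{-1}d\star$ the codifferential on $k$-forms. Let $v^\flat=g(v,\cdot)$, $\|v\|_g^2=g(v,v)$, $\iota_v$ the interior product (zero on $0$-forms), and $T_v=\mathrm{id}+v^\flat\wedge\iota_v$ on $k$-forms, which is a pointwise invertible bundle map. The $v$-induced codifferential is $\delta_v=T_v^{-1}\delta T_v$ (equivalently $(-1)^k\star_v^{-1}d\star_v$ on $k$-forms with $\star_v=\star T_v$). The space of harmonic fields is $\mathcal{H}^k(M)=\{\omega\in\Omega^k(M)\mid d\omega=0,\ \delta\omega=0\}$ and the space of $v$-harmonic fields is $\mathcal{H}^k_v(M)=\{\omega\in\Omega^k(M)\mid d\omega=0,\ \delta_v\omega=0\}$. *)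

(* Defs.v *)
From HB Require Import structures.
From mathcomp Require Import all_boot all_order all_algebra fingroup perm.
From mathcomp Require Import all_classical all_reals all_analysis.

Set Implicit Arguments.
Unset Strict Implicit.
Unset Printing Implicit Defensive.

Import Order.TTheory GRing.Theory Num.Theory.
Import numFieldNormedType.Exports.

Local Open Scope classical_set_scope.
Local Open Scope ring_scope.

(* Tensor calculus in local coordinates.  A tensor
   field on a manifold is the family of its components in all the charts of an
   atlas, subject to the usual transformation law; the value of such a family
   outside the image of a chart is irrelevant. *)

Section Calculus.
Context {R : realType} {n : nat}.
Implicit Types (D W : set 'rV[R]_n) (f : 'rV[R]_n -> R).

Definition basis_vec (i : 'I_n) : 'rV[R]_n := delta_mx 0 i.

(* For n = 0 this is the whole one-point space. *)
Definition half_space : set 'rV[R]_n :=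
  [set x | forall i : 'I_n, (i : nat) = 0%N -> 0 <= x 0 i].

Fixpoint ck_on (r : nat) W f : Prop :=
  (forall x, W x -> {for x, continuous f}) /\
  match r with
  | 0 => True
  | r'.+1 => forall i : 'I_n,
      (forall x, W x -> derivable f x (basis_vec i)) /\
      ck_on r' W (fun x => 'D_(basis_vec i) f x)
  end.

(* D need not be open: smooth means locally extendable to a smooth function on
   an open subset of R^n. *)
Definition smooth_on D f : Prop :=
  forall x, D x -> exists W (F : 'rV[R]_n -> R),
    [/\ open W, W x, (forall r, ck_on r W F) &
        forall y, D y -> W y -> f y = F y].

(* i-th partial derivative of a function on D, the increments being restricted
   to D: the usual one at interior points, one-sided in the direction normal to
   the boundary of a half space. *)
Definition pder D (i : 'I_n) f (x : 'rV[R]_n) : R :=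
  lim ((fun t : R => t^-1 * (f (x + t *: basis_vec i) - f x))
         @ within [set t : R | D (x + t *: basis_vec i)] 0^').

End Calculus.

(* The atlas is not assumed to be maximal. *)
Record manifold (R : realType) (n : nat) := Manifold {
  carrier :> topologicalType ;
  manifold_hausdorff : hausdorff_space carrier ;
  manifold_second_countable : @second_countable carrier ;
  chart : Type ;
  chart_dom : chart -> set carrier ;
  chart_img : chart -> set 'rV[R]_n ;
  chart_map : chart -> carrier -> 'rV[R]_n ;
  chart_inv : chart -> 'rV[R]_n -> carrier ;
  chart_cover : forall p : carrier, exists c, chart_dom c p ;
  chart_dom_open : forall c, open (chart_dom c) ;
  chart_img_open : forall c, open (chart_img c) \/
    exists2 W : set 'rV[R]_n, open W & chart_img c = W `&` half_space ;
  chart_mapK : forall c p, chart_dom c p ->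
    chart_img c (chart_map c p) /\ chart_inv c (chart_map c p) = p ;
  chart_invK : forall c x, chart_img c x ->
    chart_dom c (chart_inv c x) /\ chart_map c (chart_inv c x) = x ;
  chart_map_continuous : forall c,
    {within chart_dom c, continuous (chart_map c)} ;
  chart_inv_continuous : forall c,
    {within chart_img c, continuous (chart_inv c)} ;
  chart_smooth : forall c c' (j : 'I_n),
    smooth_on [set x | chart_img c x /\ chart_dom c' (chart_inv c x)]
              (fun x => chart_map c' (chart_inv c x) 0 j)
}.

Section Tensors.
Context {R : realType} {n : nat} (M : manifold R n).

Definition components (X : Type) := chart M -> 'rV[R]_n -> X.

Definition overlap (c c' : chart M) : set 'rV[R]_n :=
  [set x | chart_img c x /\ chart_dom c' (chart_inv c x)].

Definition transition (c c' : chart M) (x : 'rV[R]_n) : 'rV[R]_n :=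
  chart_map c' (chart_inv c x).

(* Row index: variable of differentiation; column index: component. *)
Definition jacobian (c c' : chart M) (x : 'rV[R]_n) : 'M[R]_n :=
  \matrix_(i, j) pder (chart_img c) i (fun y => transition c c' y 0 j) x.

Record riemannian_metric := RiemannianMetric {
  metric :> chart M -> 'rV[R]_n -> 'M[R]_n ;
  metric_sym : forall c x, chart_img c x -> (metric c x)^T = metric c x ;
  metric_pos : forall c x, chart_img c x -> forall w : 'rV[R]_n, w != 0 ->
    0 < (w *m metric c x *m w^T) 0 0 ;
  metric_smooth : forall c i j,
    smooth_on (chart_img c) (fun x => metric c x i j) ;
  metric_compat : forall c c' x, overlap c c' x ->
    metric c x = jacobian c c' x *m metric c' (transition c c' x)
                   *m (jacobian c c' x)^T
}.

(* An orientation tells, at each point of each chart, whether the coordinate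
   frame is positive (1) or negative (-1).  Asking instead for an atlas of
   positive charts would exclude negatively oriented points (n = 0) and
   segments (n = 1, both ends having charts in the same half line). *)
Record orientation := Orientation {
  orient :> chart M -> 'rV[R]_n -> R ;
  orient_sign : forall c x, chart_img c x -> orient c x = 1 \/ orient c x = -1 ;
  orient_continuous : forall c, {within chart_img c, continuous (orient c)} ;
  orient_compat : forall c c' x, overlap c c' x ->
    orient c x =
      Num.sg (\det (jacobian c c' x)) * orient c' (transition c c' x)
}.

Record vector_field := VectorField {
  vf :> chart M -> 'rV[R]_n -> 'rV[R]_n ;
  vf_smooth : forall c i, smooth_on (chart_img c) (fun x => vf c x 0 i) ;
  vf_compat : forall c c' x, overlap c c' x ->
    vf c' (transition c c' x) = vf c x *m jacobian c c' x
}.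

End Tensors.

Section Covectors.
Context {R : realType} {n : nat}.

(* A covariant k-tensor w on R^n, by its components w_(I 0 ... I (k-1)). *)
Definition covector (k : nat) := {ffun {ffun 'I_k -> 'I_n} -> R}.

Definition alternating k : set (covector k) :=
  [set w | forall (I : {ffun 'I_k -> 'I_n}) (s : 'S_k),
     w [ffun a => I (s a)] = (-1) ^+ s * w I].

Definition scale_cov k (r : R) (w : covector k) : covector k :=
  [ffun I => r * w I].

Definition del_index k (a : 'I_k.+1) (I : {ffun 'I_k.+1 -> 'I_n}) :
  {ffun 'I_k -> 'I_n} := [ffun b => I (lift a b)].

Definition wedge1 k (u : covector 1) (w : covector k) : covector k.+1 :=
  [ffun I : {ffun 'I_k.+1 -> 'I_n} =>
     \sum_(a < k.+1) (-1) ^+ a * u [ffun=> I a] * w (del_index a I)].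

Definition cons_index k (i : 'I_n) (I : {ffun 'I_k -> 'I_n}) :
  {ffun 'I_k.+1 -> 'I_n} :=
  [ffun a => if unlift ord0 a is Some b then I b else i].

Definition interior_prod k (v : 'rV[R]_n) (w : covector k.+1) : covector k :=
  [ffun I => \sum_(i < n) v 0 i * w (cons_index i I)].

(* Signature of the permutation of 'I_n listed by L; 0 if L is no such list. *)
Definition levi_civita (L : seq 'I_n) : R :=
  \sum_(s : 'S_n | [seq s i | i <- enum 'I_n] == L) (-1) ^+ s.

(* Hodge star of the inner product G and of the orientation o = 1 or -1, from
   degree k to degree l, to be used with k + l = n:
     (star w)_J = o * sqrt(det G) / k! * \sum_I w^I * epsilon_(I J),
   the indices of w^I being raised by G^-1.  Hence u /\ star w = <u, w> vol. *)
Definition star_cov (G : 'M[R]_n) (o : R) k l (w : covector k) : covector l :=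
  [ffun J : {ffun 'I_l -> 'I_n} =>
     o * Num.sqrt (\det G) / (k`!)%:R *
     \sum_(I : {ffun 'I_k -> 'I_n})
       (\sum_(K : {ffun 'I_k -> 'I_n})
          (\prod_(a < k) invmx G (I a) (K a)) * w K)
       * levi_civita (codom I ++ codom J)].

Definition cov_inverse k l (h : covector k -> covector l) :
  covector l -> covector k := 'pinv_(fun=> 0) (@alternating k) h.

End Covectors.

Section Forms.
Context {R : realType} {n : nat} {M : manifold R n}.
Variables (g : riemannian_metric M) (o : orientation M) (v : vector_field M).

Definition pform (k : nat) := components M (@covector R n k).

Definition smooth_form k : set (pform k) :=
  [set w | [/\ forall c x, chart_img c x -> alternating (w c x),
     forall c I, smooth_on (chart_img c) (fun x => w c x I) &
     forall c c' x, overlap c c' x -> forall I : {ffun 'I_k -> 'I_n},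
       w c x I = \sum_(J : {ffun 'I_k -> 'I_n})
         (\prod_(a < k) jacobian c c' x (I a) (J a))
         * w c' (transition c c' x) J]].

Definition vanishes k (w : pform k) : Prop :=
  forall c x, chart_img c x -> w c x = 0.

Definition ext_d k (w : pform k) : pform k.+1 := fun c x =>
  [ffun I : {ffun 'I_k.+1 -> 'I_n} =>
     \sum_(a < k.+1)
       (-1) ^+ a * pder (chart_img c) (I a) (fun y => w c y (del_index a I)) x].

Definition star k l (w : pform k) : pform l := fun c x =>
  star_cov (g c x) (o c x) l (w c x).

(* Inverse of the star operator from degree k to degree l. *)
Definition star_inv k l (w : pform l) : pform k := fun c x =>
  cov_inverse (@star_cov R n (g c x) (o c x) k l) (w c x).

(* The codifferential vanishes for want of nonzero forms in degree 0 (target)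
   and in degrees above n (source). *)
Definition codiff k : pform k -> pform k.-1 :=
  match k with
  | 0 => fun _ _ _ => 0
  | k'.+1 => fun w c x =>
      if (k' < n)%N then
        scale_cov ((-1) ^+ k'.+1)
          (star_inv k' (ext_d (star (n - k'.+1) w)) c x)
      else 0
  end.

Definition flat : pform 1 := fun c x =>
  [ffun I : {ffun 'I_1 -> 'I_n} => (v c x *m g c x) 0 (I ord0)].

Definition norm_sq : components M R := fun c x =>
  (v c x *m g c x *m (v c x)^T) 0 0.

Definition dir_deriv (f : components M R) : components M R := fun c x =>
  \sum_(i < n) v c x 0 i * pder (chart_img c) i (f c) x.

(* T_v = id + v^flat /\ iota_v at one point, with iota_v = 0 on 0-forms. *)
Definition T_cov (c : chart M) (x : 'rV[R]_n) k :
  @covector R n k -> @covector R n k :=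
  match k with
  | 0 => id
  | k'.+1 => fun w => w + wedge1 (flat c x) (interior_prod (v c x) w)
  end.

Definition T_op k (w : pform k) : pform k := fun c x => T_cov c x (w c x).

Definition T_inv k (w : pform k) : pform k := fun c x =>
  cov_inverse (@T_cov c x k) (w c x).

Definition codiff_v k (w : pform k) : pform k.-1 := T_inv (codiff (T_op w)).

Definition harmonic_fields k : set (pform k) :=
  [set w | [/\ smooth_form w, vanishes (ext_d w) & vanishes (codiff w)]].

Definition v_harmonic_fields k : set (pform k) :=
  [set w | [/\ smooth_form w, vanishes (ext_d w) & vanishes (codiff_v w)]].

Definition zero_function (f : components M R) : Prop :=
  forall c x, chart_img c x -> f c x = 0.

Definition constant_norm : Prop :=
  exists r : R, forall c x, chart_img c x -> Num.sqrt (norm_sq c x) = r.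

End Forms.

(* Main.v *)
Require Import Defs.
From HB Require Import structures.
From mathcomp Require Import all_boot all_order all_algebra fingroup perm.
From mathcomp Require Import all_classical all_reals all_analysis.
From mathcomp Require Import ring.

(** The equivalence is a Leibniz rule.  On 1-forms [T_v v♭ = (1 + |v|^2) v♭],
    because [ι_v v♭ = |v|^2], and [T_v] is the identity on 0-forms; so
    [δ_v v♭ = δ((1 + |v|^2) v♭)].  For every differentiable [f],
    [δ(f v♭) = f δ v♭ - v(f)] ([codiff_scale_flat]), and [δ v♭ = 0] by
    hypothesis, whence [δ_v v♭ = - v(|v|^2)] ([codiff_v_flat]).  Smoothness and
    closedness of [v♭] are common to both notions of harmonicity, and the
    derivatives of a constant [|v|^2] vanish.

    The Leibniz rule follows from the coordinate expression of the
    codifferential as a divergence ([codiff_lower_index]),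
    [δ u♭ = - ρ^-1 Σ_i ∂_i (ρ u^i)] with [ρ = ± sqrt (det g)], the sign being
    the orientation, by the product rule.  Three ingredients lead to it.

    - Combinatorics.  [⋆ u♭] has components [Σ_i ρ u^i ε(i J)], and
      differentiating it yields
      [Σ_a (-1)^a Σ_i A (J a) i ε(i, J minus J a)] with [A j i = ∂_j (ρ u^i)].
      The numbers [(-1)^a ε(i, J minus J a)] are cofactors of the matrix [P]
      with rows [e_(J a)], so [adj P P = det P] identifies the sum with
      [tr A ε(J)] ([sum_levi_civita_del_index]).  Thus [d ⋆ u♭] is a multiple
      of the volume form, which lies in the range of [⋆] on functions: only
      there is [star_inv] an inverse ([cov_inverse_star0]).

    - Positivity of [det g] ([posdef_det_gt0]), which makes [ρ] nonzero and
      differentiable.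

    - Calculus.  [pder] is the limit of a difference quotient over the
      increments that stay in the image of the chart, one-sided at the
      boundary, and is meaningless where the limit does not exist.  Hence sums,
      products, determinants and square roots are all handled by a relation
      [has_pder] that asserts the convergence; [smooth_has_some_pder] and
      [has_pder_orient] (an orientation is locally constant) supply the base
      cases. *)

Set Implicit Arguments.
Unset Strict Implicit.
Unset Printing Implicit Defensive.

Import Order.TTheory GRing.Theory Num.Theory.
Import numFieldNormedType.Exports.

Local Open Scope classical_set_scope.
Local Open Scope ring_scope.

(** * Levi-Civita symbols and the pointwise Hodge star *)

Section Algebra.
Context {R : realType}.

Definition index_mx n (J : {ffun 'I_n -> 'I_n}) : 'M[R]_n :=
  \matrix_(a, i) (J a == i)%:R.

(** In the Leibniz formula only the permutation that lists [J], if any, has a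
    nonzero term. *)
Lemma levi_civita_det n (J : {ffun 'I_n -> 'I_n}) :
  levi_civita (codom J) = \det (index_mx J) :> R.
Proof.
rewrite /levi_civita /determinant big_mkcond; apply: eq_bigr => s _.
have -> : ([seq s i | i <- enum 'I_n] == codom J) = [forall i, J i == s i].
  rewrite codomE; apply/eqP/forallP => [/eq_in_map sJ i|sJ].
    by rewrite sJ ?mem_enum.
  by apply: eq_map => i; apply/esym/eqP.
case: ifPn => [/forallP sJ|/forallPn[i /negPf sJ]].
  by rewrite big1 ?mulr1// => i _; rewrite mxE sJ.
by rewrite (bigD1 i)//= mxE sJ mul0r mulr0.
Qed.

Lemma codom_cons_index n l (i : 'I_n) (J : {ffun 'I_l -> 'I_n}) :
  codom (cons_index i J) = i :: codom J.
Proof.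
rewrite !codomE enum_ordSl /= ffunE unlift_none -map_comp; congr (_ :: _).
by apply: eq_map => a /=; rewrite ffunE liftK.
Qed.

(** Both sides are the determinant of [index_mx J] with its row [a] replaced by
    the basis vector [e_i]: on the left the new row has been moved to the top,
    past [a] rows. *)
Lemma levi_civita_del_index l (i : 'I_l.+1) (a : 'I_l.+1)
    (J : {ffun 'I_l.+1 -> 'I_l.+1}) :
  (-1) ^+ a * levi_civita (i :: codom (del_index a J))
    = cofactor (index_mx J) a i :> R.
Proof.
rewrite -codom_cons_index levi_civita_det (expand_det_row _ ord0) (bigD1 i)//=.
rewrite big1 => [|j ji]; last first.
  by rewrite mxE ffunE unlift_none eq_sym (negPf ji) mul0r.
rewrite mxE ffunE unlift_none eqxx mul1r addr0 /cofactor add0n exprD -mulrA.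
congr (_ * (_ * \det _)); apply/matrixP => b j.
by rewrite !mxE ffunE liftK ffunE.
Qed.

(** The left-hand side is the trace of [P A adj P] for [P = index_mx J]. *)
Lemma sum_levi_civita_del_index n l (A : 'M[R]_n)
    (J : {ffun 'I_l.+1 -> 'I_n}) :
  l.+1 = n ->
  \sum_(a < l.+1) (-1) ^+ a *
    (\sum_i A (J a) i * levi_civita (i :: codom (del_index a J)))
  = \tr A * levi_civita (codom J).
Proof.
move=> ln; case: n / ln in A J *.
transitivity (\tr (index_mx J *m A *m \adj (index_mx J))).
  apply: eq_bigr => a _; rewrite mxE mulr_sumr; apply: eq_bigr => i _.
  rewrite !mxE -levi_civita_del_index mulrCA; congr (_ * _).
  rewrite (bigD1 (J a))//= mxE eqxx mul1r big1 ?addr0// => j jJ.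
  by rewrite mxE eq_sym (negPf jJ) mul0r.
rewrite -mulmxA mxtrace_mulC -mulmxA mul_adj_mx mul_mx_scalar mxtraceZ mulrC.
by rewrite levi_civita_det.
Qed.

Lemma levi_civita_neq0 n l : l = n ->
  exists J : {ffun 'I_l -> 'I_n}, levi_civita (codom J) != 0 :> R.
Proof.
move=> ln; case: n / ln; exists (finfun id).
rewrite levi_civita_det (_ : index_mx _ = 1%:M) ?det1 ?oner_neq0//.
by apply/matrixP => i j; rewrite !mxE ffunE.
Qed.

(** [cov_inverse] inverts the star only on its range and takes a default value
    elsewhere; multiples of the Levi-Civita symbol are in that range. *)
Lemma cov_inverse_star0 n l (G : 'M[R]_n) (o a : R) : l = n ->
  o * Num.sqrt (\det G) != 0 ->
  cov_inverse (@star_cov R n G o 0 l)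
      [ffun J : {ffun 'I_l -> 'I_n} => a * levi_civita (codom J)]
    = [ffun=> a / (o * Num.sqrt (\det G))].
Proof.
move=> ln rho0.
have starE (w : @covector R n 0) I : star_cov G o l w =
    [ffun J : {ffun 'I_l -> 'I_n} =>
       o * Num.sqrt (\det G) * w I * levi_civita (codom J)].
  apply/ffunP => J; rewrite !ffunE fact0 divr1 -[RHS]mulrA; congr (_ * _).
  rewrite (big_pred1 I) => [|I']; last by apply/esym/eqP/ffunP => -[].
  rewrite (big_pred1 I) => [|I']; last by apply/esym/eqP/ffunP => -[].
  by rewrite big_ord0 mul1r codomE (size0nil (size_enum_ord 0)).
pose I0 : {ffun 'I_0 -> 'I_n} := ffun0 (card_ord 0).
have star_inj :
    {in @Defs.alternating R n 0 &, injective (@star_cov R n G o 0 l)}.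
  move=> w w' _ _ ww'; apply/ffunP => I; have [J J0] := levi_civita_neq0 ln.
  move/ffunP: ww' => /(_ J); rewrite !(starE _ I) !ffunE.
  by move/(mulIf J0)/(mulfI rho0).
have -> : [ffun J : {ffun 'I_l -> 'I_n} => a * levi_civita (codom J)]
    = star_cov G o l ([ffun=> a / (o * Num.sqrt (\det G))] : covector 0).
  rewrite (starE _ I0); apply/ffunP => J.
  by rewrite !ffunE mulrCA divff// mulr1.
rewrite /cov_inverse (pinvKV _ star_inj)// inE /Defs.alternating /= => I s.
rewrite !ffunE; suff -> : s = 1%g by rewrite odd_perm1 mul1r.
by apply/permP => -[].
Qed.

(** Lowering the index of [u] cancels the raising of indices performed by the
    star, so the star of [u♭] does not involve the inverse of [G]. *)
Lemma star_cov1 n l (G : 'M[R]_n) (o : R) (u : 'rV[R]_n) :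
  G \in unitmx -> G^T = G ->
  star_cov G o l [ffun I : {ffun 'I_1 -> 'I_n} => (u *m G) 0 (I ord0)]
  = [ffun J : {ffun 'I_l -> 'I_n} =>
      \sum_i o * Num.sqrt (\det G) * u 0 i * levi_civita (i :: codom J)].
Proof.
move=> G_unit G_sym; apply/ffunP => J.
rewrite !ffunE (_ : 1`!%N = 1%N) // divr1 mulr_sumr.
have bij1 : bijective (fun i : 'I_n => [ffun=> i] : {ffun 'I_1 -> 'I_n}).
  exists (fun I : {ffun 'I_1 -> 'I_n} => I ord0) => [i|I].
    by rewrite ffunE.
  by apply/ffunP => a; rewrite ffunE (ord1 a).
rewrite (reindex _ (onW_bij predT bij1)) /=; apply: eq_bigr => i _.
rewrite -!mulrA; congr (_ * (_ * _)).
rewrite (reindex _ (onW_bij predT bij1)) /=.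
have -> : codom ([ffun=> i] : {ffun 'I_1 -> 'I_n}) = [:: i].
  by rewrite codomE enum_ordSl /= ffunE (size0nil (size_enum_ord 0)).
congr (_ * _); transitivity ((u *m G *m invmx G) 0 i); last by rewrite mulmxK.
rewrite mxE; apply: eq_bigr => k _.
rewrite big_ord1 !ffunE mulrC; congr (_ * _).
by rewrite -[in RHS]G_sym -trmx_inv mxE.
Qed.

(** On the segment from the identity to [G] all matrices are positive definite,
    hence nonsingular; the determinant, a polynomial in the parameter that is
    1 at one end, cannot be nonpositive at the other. *)
Lemma posdef_det_gt0 n (G : 'M[R]_n) :
  (forall w : 'rV[R]_n, w != 0 -> 0 < (w *m G *m w^T) 0 0) -> 0 < \det G.
Proof.
move=> G_gt0.
pose H (t : R) : 'M[R]_n := (1 - t) *: 1%:M + t *: G.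
have H_neq0 t : 0 <= t <= 1 -> \det (H t) != 0.
  move=> /andP[t0 t1]; apply/det0P => -[w w0 wH].
  have ww : 0 < (w *m w^T) 0 0.
    rewrite mxE lt_def sumr_ge0 ?andbT => [|i _]; last first.
      by rewrite mxE -expr2 sqr_ge0.
    apply: contra_neq w0 => /psumr_eq0P w0; apply/rowP => i.
    have := w0 (fun j _ => _) i isT.
    rewrite !mxE => /(_ _)/eqP; rewrite mulf_eq0 orbb => /(_ _)/eqP; apply.
    by move=> j; rewrite mxE -expr2 sqr_ge0.
  have : (w *m H t *m w^T) 0 0 = 0 by rewrite wH mul0mx mxE.
  rewrite mulmxDr mulmxDl -!scalemxAr mulmx1 -!scalemxAl mxE [X in X + _]mxE.
  rewrite [X in _ + X]mxE.
  have := G_gt0 _ w0; move: (_ 0 0) ww (_ 0 0) => a a0 b b0 ab.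
  have [t_eq1|t_lt1] := eqVneq t 1.
    by move: ab b0; rewrite t_eq1 subrr mul0r add0r mul1r => ->; rewrite ltxx.
  suff : 0 < (1 - t) * a + t * b by rewrite ab ltxx.
  apply: ltr_wpDr; first by rewrite mulr_ge0// ltW.
  by rewrite mulr_gt0// subr_gt0 lt_neqAle t_lt1.
pose p : {poly R} :=
  \det ((1 - 'X) *: 1%:M + 'X *: map_mx polyC G).
have pE t : p.[t] = \det (H t).
  rewrite -horner_evalE -det_map_mx; congr (\det _).
  apply/matrixP => i j; rewrite !mxE /horner_eval.
  change (((1 - 'X) * (i == j)%:R + 'X * (G i j)%:P : {poly R}).[t]
    = (1 - t) * (i == j)%:R + t * G i j).
  by case: (i == j); rewrite !hornerE.
rewrite ltNge; apply/negP => G_le0.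
have p01 : (- p).[0] <= 0 <= (- p).[1].
  rewrite !hornerN !pE /H subr0 subrr !scale0r !scale1r add0r addr0 det1.
  by rewrite oppr_ge0 G_le0 lerN10.
have [t t01] := poly_ivt ler01 p01.
by rewrite /root hornerN oppr_eq0 pE (negPf (H_neq0 _ t01)).
Qed.

End Algebra.

(** * Partial derivatives along a chart image *)

Section PartialDerivatives.
Context {R : realType} {n : nat} (D : set 'rV[R]_n) (i : 'I_n) (x : 'rV[R]_n).

(** The filter in the definition of [pder]. *)
Definition increments : set_system R :=
  within [set t : R | D (x + t *: basis_vec i)] 0^'.

Definition has_pder (f : 'rV[R]_n -> R) (l : R) : Prop :=
  t^-1 * (f (x + t *: basis_vec i) - f x) @[t --> increments] --> l.

#[local] Instance increments_filter : Filter increments.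
Proof. exact: within_filter. Qed.

Lemma cvg_along_increments : x + t *: basis_vec i @[t --> increments] --> x.
Proof.
apply: cvg_within_filter.
apply: (@cvg_trans _ ((x + t *: basis_vec i) @[t --> nbhs (0 : R)])).
  by apply: cvg_app; exact: nbhs_dnbhs.
have {2}-> : x = x + (0 : R) *: basis_vec i by rewrite scale0r addr0.
by apply: cvgD; [exact: cvg_cst|apply: cvgZr_tmp; exact: cvg_id].
Qed.

Lemma near_increments (P : set 'rV[R]_n) :
  (\forall y \near within D (nbhs x), P y) ->
  \forall t \near increments, P (x + t *: basis_vec i).
Proof.
move=> nP; have nDP : increments [set t | D (x + t *: basis_vec i) ->
  P (x + t *: basis_vec i)] by exact: cvg_along_increments nP.
have nD : increments [set t | D (x + t *: basis_vec i)] by exact: withinT.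
by apply: filterS2 nD nDP => t Dt; apply.
Qed.

Lemma has_pder_near (f h : 'rV[R]_n -> R) l :
  f x = h x -> (\forall y \near within D (nbhs x), f y = h y) ->
  has_pder h l -> has_pder f l.
Proof.
move=> fhx /near_increments fh; apply: cvg_trans; apply: near_eq_cvg.
by apply: filterS fh => t /= ->; rewrite fhx.
Qed.

Lemma has_pder_eq (f h : 'rV[R]_n -> R) l :
  D x -> (forall y, D y -> f y = h y) -> has_pder h l -> has_pder f l.
Proof.
move=> Dx fh; apply: has_pder_near; first exact: fh.
by apply: filterS (withinT D _).
Qed.

Lemma has_pder_cst (a : R) : has_pder (fun=> a) 0.
Proof.
by rewrite /has_pder subrr; under eq_fun do rewrite mulr0; exact: cvg_cst.
Qed.

Lemma has_pderD (f h : 'rV[R]_n -> R) l m :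
  has_pder f l -> has_pder h m -> has_pder (f \+ h) (l + m).
Proof.
move=> fl hm; apply: (cvg_trans _ (cvgD fl hm)); apply: near_eq_cvg.
by apply: nearW => t; rewrite !fctE /=; ring.
Qed.

Lemma has_pder_cvg f l : has_pder f l ->
  f (x + t *: basis_vec i) @[t --> increments] --> f x.
Proof.
move=> fl.
have t0 : t @[t --> increments] --> (0 : R).
  by apply: cvg_within_filter; exact: nbhs_dnbhs.
have f_cvg : f x + t * (t^-1 * (f (x + t *: basis_vec i) - f x))
    @[t --> increments] --> f x.
  have {3}-> : f x = f x + 0 * l by rewrite mul0r addr0.
  exact: cvgD (cvg_cst (f x)) (cvgM t0 fl).
apply: (cvg_trans _ f_cvg); apply: near_eq_cvg.
near=> t; rewrite /= mulrA divff ?mul1r ?subrKC //.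
near: t; suff : increments [set t | t != 0] by [].
by apply: filterS (nbhs_dnbhs_neq (0 : R)).
Unshelve. all: by end_near. Qed.

Lemma has_pderM (f h : 'rV[R]_n -> R) l m :
  has_pder f l -> has_pder h m -> has_pder (f \* h) (l * h x + f x * m).
Proof.
move=> fl hm.
apply: (cvg_trans _ (cvgD (cvgM fl (cvg_cst (h x)))
                          (cvgM (has_pder_cvg fl) hm))).
apply: near_eq_cvg.
by apply: nearW => t; rewrite !fctE /=; ring.
Qed.

Definition has_some_pder f := exists l, has_pder f l.

Lemma has_pder_sum (I : Type) (r : seq I) (F : I -> 'rV[R]_n -> R)
    (l : I -> R) :
  (forall j, has_pder (F j) (l j)) ->
  has_pder (fun y => \sum_(j <- r) F j y) (\sum_(j <- r) l j).
Proof.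
move=> dF; elim: r => [|j r IH].
  rewrite big_nil (_ : (fun y => _) = fun=> 0); first exact: has_pder_cst.
  by apply/funext => y; rewrite big_nil.
rewrite big_cons (_ : (fun y => _) = F j \+ (fun y => \sum_(k <- r) F k y)).
  exact: has_pderD.
by apply/funext => y; rewrite big_cons.
Qed.

Lemma has_some_pder_sum (I : Type) (r : seq I) (F : I -> 'rV[R]_n -> R) :
  (forall j, has_some_pder (F j)) ->
  has_some_pder (fun y => \sum_(j <- r) F j y).
Proof. by move=> /choice[l dF]; eexists; exact: has_pder_sum dF. Qed.

Lemma has_some_pder_prod (I : Type) (r : seq I) (F : I -> 'rV[R]_n -> R) :
  (forall j, has_some_pder (F j)) ->
  has_some_pder (fun y => \prod_(j <- r) F j y).
Proof.
move=> dF; elim: r => [|j r [l IH]].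
  exists 0; rewrite (_ : (fun y => _) = fun=> 1); first exact: has_pder_cst.
  by apply/funext => y; rewrite big_nil.
rewrite (_ : (fun y => _) = F j \* (fun y => \prod_(k <- r) F k y)).
  by have [m dFj] := dF j; eexists; exact: has_pderM dFj IH.
by apply/funext => y; rewrite big_cons.
Qed.

Lemma has_some_pderM (f h : 'rV[R]_n -> R) :
  has_some_pder f -> has_some_pder h -> has_some_pder (f \* h).
Proof. by move=> [l fl] [m hm]; eexists; exact: has_pderM fl hm. Qed.

Lemma has_some_pder_det k (F : 'rV[R]_n -> 'M[R]_k) :
  (forall a b, has_some_pder (fun y => F y a b)) ->
  has_some_pder (fun y => \det (F y)).
Proof.
move=> dF; apply: has_some_pder_sum => s.
apply: has_some_pderM; first by exists 0; exact: has_pder_cst.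
exact: has_some_pder_prod.
Qed.

(** [(sqrt a - sqrt b) / t = ((a - b) / t) / (sqrt a + sqrt b)]. *)
Lemma has_some_pder_sqrt (f : 'rV[R]_n -> R) :
  0 < f x -> has_some_pder f -> has_some_pder (fun y => Num.sqrt (f y)).
Proof.
move=> fx0 [l fl]; exists (l / (Num.sqrt (f x) + Num.sqrt (f x))).
have f_cvg := has_pder_cvg fl.
have sf_cvg : Num.sqrt (f (x + t *: basis_vec i)) @[t --> increments]
    --> Num.sqrt (f x).
  exact: (cvg_comp _ _ f_cvg (@sqrt_continuous R (f x))).
have sfx0 : Num.sqrt (f x) + Num.sqrt (f x) != 0.
  by rewrite gt_eqF// addr_gt0// sqrtr_gt0.
apply: (cvg_trans _ (cvgM fl (cvgV sfx0
                     (cvgD sf_cvg (cvg_cst (Num.sqrt (f x))))))).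
apply: near_eq_cvg; near=> t; rewrite !fctE /=.
have ft0 : 0 <= f (x + t *: basis_vec i).
  by apply: ltW; near: t; exact: (cvgr_gt _ f_cvg _ fx0).
rewrite -{1}(sqr_sqrtr ft0) -{1}(sqr_sqrtr (ltW fx0)) subr_sqr mulrA mulfK//.
by rewrite gt_eqF// ltr_wpDl ?sqrtr_ge0// sqrtr_gt0.
Unshelve. all: by end_near. Qed.

Lemma smooth_has_some_pder f : smooth_on D f -> D x -> has_some_pder f.
Proof.
move=> sf Dx; have [W [F [Wo Wx ckF fF]]] := sf x Dx.
have [_ /(_ i) [/(_ x Wx) dF _]] := ckF 1%N.
exists ('D_(basis_vec i) F x); apply: (@has_pder_near f F).
- exact: fF.
- rewrite /within /=; apply: filterS (open_nbhs_nbhs (conj Wo Wx)) => y Wy Dy.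
  exact: fF.
- rewrite /has_pder; apply: cvg_within_filter.
  rewrite (_ : (fun t => _) =
    fun t => t^-1 *: ((F \o shift x) (t *: basis_vec i) - F x)).
    exact: dF.
  by apply/funext => t; rewrite /= (addrC x).
Qed.

Lemma pderE f l : ProperFilter (increments) -> has_pder f l -> pder D i f x = l.
Proof. by move=> ? fl; apply: (cvg_lim _ fl); exact: norm_hausdorff. Qed.

(** Small positive increments stay in [D]: in the half space they can only
    increase the coordinate that has to be nonnegative. *)
Lemma increments_proper :
  (open D \/ exists2 W : set 'rV[R]_n, open W & D = W `&` half_space) ->
  D x -> ProperFilter increments.
Proof.
move=> D_open Dx; have [W [Wo Wx WD]] : exists W : set 'rV[R]_n,
    [/\ open W, W x & forall t, 0 < t -> W (x + t *: basis_vec i) ->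
      D (x + t *: basis_vec i)].
  case: D_open => [Do|[W Wo DE]]; first by exists D.
  move: Dx; rewrite DE => -[Wx x_ge0]; exists W; split=> // t t0 Wt.
  split=> // j j0; rewrite !mxE addr_ge0 ?x_ge0//.
  by rewrite mulr_ge0 ?ler0n// ltW.
apply: (Build_ProperFilter_ex _ increments_filter) => P.
rewrite /increments /within /= => nP.
have nP_right : \forall t \near (0 : R)^'+, D (x + t *: basis_vec i) -> P t.
  have {}nP : nbhs (0 : R) [set t | t != 0 -> D (x + t *: basis_vec i) -> P t].
    exact: nP.
  suff : nbhs (0 : R) [set t | 0 < t -> D (x + t *: basis_vec i) -> P t] by [].
  by apply: filterS nP => t tP t0; apply: tP; rewrite gt_eqF.
have nW : \forall t \near (0 : R)^'+, W (x + t *: basis_vec i).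
  have xt : x + t *: basis_vec i @[t --> (0 : R)^'+] --> x.
    have {2}-> : x = x + (0 : R) *: basis_vec i by rewrite scale0r addr0.
    apply: cvgD; first exact: cvg_cst.
    by apply: cvgZr_tmp; exact: cvg_at_right_filter.
  exact: xt (open_nbhs_nbhs (conj Wo Wx)).
have [t [tP [tW t0]]] :=
  filter_ex (filterI nP_right (filterI nW (nbhs_right_gt 0))).
by exists t; apply: tP; apply: WD.
Qed.

End PartialDerivatives.

(** * The codifferential of a 1-form as a divergence *)

Section Codifferential.
Context {R : realType} {n : nat} {M : manifold R n}.
Variables (g : riemannian_metric M) (o : orientation M).
Implicit Types (c : chart M) (x : 'rV[R]_n) (u : components M 'rV[R]_n).

Definition volume_density : components M R := fun c x =>
  o c x * Num.sqrt (\det (g c x)).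

(** [flat g v] for a field of vectors [u] given by arbitrary components: the
    divergence formula is applied to [f v], which is not packaged as a
    [vector_field]. *)
Definition lower_index u : @pform R n M 1 := fun c x =>
  [ffun I : {ffun 'I_1 -> 'I_n} => (u c x *m g c x) 0 (I ord0)].

Lemma det_metric_gt0 c x : chart_img c x -> 0 < \det (g c x).
Proof. by move=> cx; apply: posdef_det_gt0 => w; exact: metric_pos. Qed.

Lemma volume_density_neq0 c x : chart_img c x -> volume_density c x != 0.
Proof.
move=> cx; rewrite mulf_neq0//.
  by have [->|->] := orient_sign o cx; rewrite ?oppr_eq0 oner_neq0.
by rewrite gt_eqF// sqrtr_gt0 det_metric_gt0.
Qed.

Lemma chart_increments_proper c i x :
  chart_img c x -> ProperFilter (increments (chart_img c) i x).
Proof. by apply: increments_proper; exact: chart_img_open. Qed.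

(** The values 1 and -1 are at distance 2, so continuity makes the orientation
    constant near [x]. *)
Lemma has_pder_orient c i x :
  chart_img c x -> has_pder (chart_img c) i x (o c) 0.
Proof.
move=> cx.
apply: (has_pder_near (h := fun=> o c x)) => //; last exact: has_pder_cst.
have oc : o c y @[y --> within (chart_img c) (nbhs x)] --> o c x.
  by have /subspace_continuousP/(_ x cx) := @orient_continuous _ _ _ o c.
have close : \forall y \near within (chart_img c) (nbhs x),
    `|o c x - o c y| < 1.
  exact: (@cvgr_dist_lt R _ _ (within (chart_img c) (nbhs x)) _
            (o c) (o c x) oc 1 ltr01).
have inD : \forall y \near within (chart_img c) (nbhs x), chart_img c y.
  exact: withinT.
apply: filterS2 close inD => y xy cy; move: xy.
have [->|->] := orient_sign o cx; have [->|->] := orient_sign o cy => //.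
- by rewrite opprK ger0_norm// gtrDl ltr10.
- by rewrite -opprD normrN ger0_norm// gtrDl ltr10.
Qed.

Lemma has_some_pder_volume_density c i x :
  chart_img c x -> has_some_pder (chart_img c) i x (volume_density c).
Proof.
move=> cx; apply: has_some_pderM; first by exists 0; exact: has_pder_orient.
apply: has_some_pder_sqrt; first exact: det_metric_gt0.
apply: has_some_pder_det => a b; apply: smooth_has_some_pder => //.
exact: metric_smooth.
Qed.

Lemma star_lower_index l u c x : chart_img c x ->
  star g o l (lower_index u) c x =
  [ffun J : {ffun 'I_l -> 'I_n} => \sum_i volume_density c x * u c x 0 i *
     levi_civita (i :: codom J)].
Proof.
move=> cx; apply: star_cov1; last exact: Defs.metric_sym.
by rewrite unitmxE unitfE gt_eqF// det_metric_gt0.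
Qed.

Lemma ext_d_star_lower_index l u c x (m : 'M[R]_n) : l.+1 = n ->
  chart_img c x ->
  (forall i j, has_pder (chart_img c) i x
     (fun y => volume_density c y * u c y 0 j) (m i j)) ->
  ext_d (star g o l (lower_index u)) c x =
  [ffun J : {ffun 'I_l.+1 -> 'I_n} => \tr m * levi_civita (codom J)].
Proof.
move=> ln cx dm; apply/ffunP => J; rewrite !ffunE -sum_levi_civita_del_index//.
apply: eq_bigr => a _; congr (_ * _).
apply: pderE; first exact: chart_increments_proper.
apply: (has_pder_eq (h := fun y => \sum_i volume_density c y * u c y 0 i *
     levi_civita (i :: codom (del_index a J)))) => // [y cy|].
  by rewrite star_lower_index// ffunE.
apply: has_pder_sum => i.
have := has_pderM (dm (J a) i)
  (has_pder_cst _ _ _ (levi_civita (i :: codom (del_index a J)))).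
by rewrite mulr0 addr0.
Qed.

(** [δ u♭ = - div u]; for [n = 0] both sides vanish, the trace being empty. *)
Lemma codiff_lower_index u c x (m : 'M[R]_n) : chart_img c x ->
  (forall i j, has_pder (chart_img c) i x
     (fun y => volume_density c y * u c y 0 j) (m i j)) ->
  codiff g o (lower_index u) c x = [ffun=> - (\tr m / volume_density c x)].
Proof.
move=> cx dm; rewrite /codiff; case: ifPn => [n0|].
  have ln : (n - 1).+1 = n by rewrite subn1 prednK.
  rewrite /star_inv (ext_d_star_lower_index ln cx dm) cov_inverse_star0//.
    by apply/ffunP => I; rewrite !ffunE expr1 mulN1r.
  exact: volume_density_neq0.
rewrite -eqn0Ngt => /eqP n0; apply/ffunP => I; rewrite !ffunE.
rewrite /mxtrace big1 ?mul0r ?oppr0// => i _; case: i => i Hi; exfalso.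
by move: Hi; rewrite n0.
Qed.

(** * The induced codifferential of the dual of a vector field *)

Variable v : vector_field M.

(** [δ(f v♭) = f δ v♭ - v(f)]: the product rule for [∂_i (f ρ v^i)]. *)
Lemma codiff_scale_flat (f : components M R) c x (df : 'I_n -> R) :
  chart_img c x ->
  (forall i, has_pder (chart_img c) i x (f c) (df i)) ->
  codiff g o (fun c x => scale_cov (f c x) (flat g v c x)) c x =
  [ffun I => f c x * codiff g o (flat g v) c x I - dir_deriv v f c x].
Proof.
move=> cx fdf.
have fE : (fun c x => scale_cov (f c x) (flat g v c x))
    = lower_index (fun c x => f c x *: v c x).
  apply/funext => c'; apply/funext => y; apply/ffunP => I.
  by rewrite !ffunE -scalemxAl [RHS]mxE.
have /choice[r dr] : forall ij : 'I_n * 'I_n, exists d,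
    has_pder (chart_img c) ij.1 x
      (fun y => volume_density c y * v c y 0 ij.2) d.
  move=> ij; apply: has_some_pderM; first exact: has_some_pder_volume_density.
  by apply: smooth_has_some_pder => //; exact: vf_smooth.
have -> : codiff g o (flat g v) c x =
    [ffun=> - (\tr (\matrix_(i, j) r (i, j)) / volume_density c x)].
  apply: (@codiff_lower_index v) => // i j; rewrite mxE; exact: (dr (i, j)).
have dfr i j : has_pder (chart_img c) i x
    (fun y => volume_density c y * (f c y *: v c y) 0 j)
    ((\matrix_(i, j) (df i * (volume_density c x * v c x 0 j)
                        + f c x * r (i, j))) i j).
  rewrite mxE; apply: has_pder_eq (has_pderM (fdf i) (dr (i, j))) => // y _.
  by rewrite /= !mxE mulrCA.
rewrite fE (codiff_lower_index cx dfr); apply/ffunP => I.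
rewrite !ffunE mulrN -opprD; congr (- _).
rewrite /mxtrace !mulr_suml mulr_sumr /dir_deriv -big_split /=.
apply: eq_bigr => i _; rewrite !mxE.
rewrite (pderE (chart_increments_proper i cx) (fdf i)).
by field; exact: volume_density_neq0.
Qed.

Lemma T_flat : T_op g v (flat g v)
  = fun c x => scale_cov (1 + norm_sq g v c x) (flat g v c x).
Proof.
apply/funext => c; apply/funext => x; apply/ffunP => I.
rewrite /T_op /T_cov /= ![in LHS]ffunE big_ord1 expr0 mul1r !ffunE mulrDl mul1r.
rewrite (ord1 ord0) mulrC; congr (_ + _ * _).
rewrite /norm_sq mxE; apply: eq_bigr => i _.
by rewrite !mxE !ffunE unlift_none mulrC mxE.
Qed.

Lemma has_some_pder_norm_sq c i x : chart_img c x ->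
  has_some_pder (chart_img c) i x (norm_sq g v c).
Proof.
move=> cx.
have dv j : has_some_pder (chart_img c) i x (fun y => v c y 0 j).
  by apply: smooth_has_some_pder => //; exact: vf_smooth.
have -> : norm_sq g v c = fun y =>
    \sum_j (\sum_k v c y 0 k * g c y k j) * v c y 0 j.
  apply/funext => y; rewrite /norm_sq mxE; apply: eq_bigr => j _.
  by rewrite mxE [X in _ * X]mxE.
apply: has_some_pder_sum => j; apply: has_some_pderM => //.
apply: has_some_pder_sum => k; apply: has_some_pderM => //.
by apply: smooth_has_some_pder => //; exact: metric_smooth.
Qed.

(** On 0-forms [T_v] is the identity, and every 0-covector is alternating, so
    the partial inverse is everywhere the identity. *)
Lemma T_inv0 (w : @pform R n M 0) c x : T_inv g v w c x = w c x.
Proof.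
rewrite /T_inv /cov_inverse /T_cov.
have idE :
    {in @Defs.alternating R n 0 &, injective (@id (@covector R n 0))} by [].
apply: (pinvKV _ idE); rewrite inE /Defs.alternating /= => I s.
have -> : s = 1%g by apply/permP => -[].
rewrite odd_perm1 mul1r; congr (w c x _).
by apply/ffunP => -[].
Qed.

(** The Leibniz rule with [f = 1 + |v|^2]; the constant 1 contributes nothing
    to [v(f)]. *)
Lemma codiff_v_flat c x : chart_img c x ->
  codiff_v g o v (flat g v) c x =
  [ffun I => (1 + norm_sq g v c x) * codiff g o (flat g v) c x I
             - dir_deriv v (norm_sq g v) c x].
Proof.
move=> cx.
have /choice[d dN] : forall i, exists l,
    has_pder (chart_img c) i x (norm_sq g v c) l.
  by move=> i; exact: has_some_pder_norm_sq.
rewrite /codiff_v T_inv0 T_flat.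
have dN1 i : has_pder (chart_img c) i x (fun y => 1 + norm_sq g v c y) (d i).
  by rewrite -[d i]add0r; apply: has_pderD (dN i); exact: has_pder_cst.
rewrite (codiff_scale_flat cx dN1); apply/ffunP => I; rewrite !ffunE.
congr (_ - _); apply: eq_bigr => i _.
have iP := chart_increments_proper i cx.
by rewrite (pderE iP (dN1 i)) (pderE iP (dN i)).
Qed.

End Codifferential.

Theorem proposition5p1 (R : realType) (n : nat) (M : manifold R n)
    (M_compact : compact [set: M])
    (g : riemannian_metric M) (o : orientation M) (v : vector_field M)
    (v_harmonic : harmonic_fields g o (flat g v)) :
  (v_harmonic_fields g o v (flat g v) <->
     zero_function (dir_deriv v (norm_sq g v))) /\
  (constant_norm g v -> v_harmonic_fields g o v (flat g v)).
Proof.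
have [v_smooth v_closed v_coclosed] := v_harmonic.
have codiff_vE c x : chart_img c x -> codiff_v g o v (flat g v) c x =
    [ffun=> - dir_deriv v (norm_sq g v) c x].
  move=> cx; rewrite codiff_v_flat// v_coclosed//.
  by apply/ffunP => I; rewrite !ffunE mulr0 sub0r.
have harmonicP : v_harmonic_fields g o v (flat g v) <->
    zero_function (dir_deriv v (norm_sq g v)).
  split=> [[_ _ v_coclosed'] c x cx|dN0].
    have /ffunP/(_ (ffun0 (card_ord 0))) := v_coclosed' c x cx.
    by rewrite codiff_vE// !ffunE => /eqP; rewrite oppr_eq0 => /eqP.
  split=> // c x cx; rewrite codiff_vE// dN0//.
  by apply/ffunP => I; rewrite !ffunE oppr0.
split=> // -[r v_norm]; apply/harmonicP => c x cx.
rewrite /dir_deriv big1// => i _.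
suff -> : pder (chart_img c) i (norm_sq g v c) x = 0 by rewrite mulr0.
apply: pderE; first exact: chart_increments_proper.
apply: has_pder_eq (has_pder_cst _ _ _ (r ^+ 2)) => // y cy.
rewrite -(v_norm c y cy) sqr_sqrtr//.
have [v0|v0] := eqVneq (v c y) 0; first by rewrite /norm_sq v0 !mul0mx mxE.
by apply: ltW; exact: metric_pos.
Qed.
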